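(* Let $C$ be a non-Frobenius $i$-collision over $\mathbb{F}_q$ with $i\ge 2$ at degree $p^2$, and let $k$ be the integer with $1\le k<p$ such that $\deg_2(g)=\deg_2(h)=k$ for all $(g,h)\in C$. Then $k=1$ or $k>p/2$.
   Context: $\mathbb{F}_q$ is a finite field of characteristic $p$. All polynomials are in $\mathbb{F}_q[x]$, monic and original (vanishing at $0$). An $i$-collision at degree $p^2$ is a set of $i$ distinct pairs $(g,h)$ with $\deg g=\deg h=p$, all with the same composition $f=g\circ h$ (of degree $p^2$). A Frobenius collision is a $2$-collision $\{(x^p,h),(\sigma_p(h),x^p)\}$ with $\deg h=p$, $h\ne x^p$, where $\sigma_p$ raises each coefficient to the $p$th power; non-Frobenius means not of this form. The second-degree of a polynomial $v$ is $\deg_2v=\deg(v-\mathrm{lc}(v)x^{\deg v})$, where $\mathrm{lc}$ is the leading coefficient, with $\deg_2v=-\infty$ for monomials and zero. For every such collision $C$ an integer $k$ as described exists (and is unique). *)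

(* Defs.v *)
From HB Require Import structures.
From mathcomp Require Import all_boot all_order all_algebra.
From mathcomp Require Import finmap.

Set Implicit Arguments.
Unset Strict Implicit.
Unset Printing Implicit Defensive.

Import GRing.Theory.
Local Open Scope ring_scope.
Local Open Scope fset_scope.

Section Collisions.

Variable F : finFieldType.
Implicit Types (v g h : {poly F}) (p i : nat) (C : {fset {poly F} * {poly F}}).

(* [None] stands for -oo, the degree of the zero polynomial. *)
Definition deg v : option nat := if v == 0 then None else Some (size v).-1.

Definition deg2 v : option nat :=
  deg (v - lead_coef v *: 'X^((size v).-1)).

Definition monic_original v : Prop := v \is monic /\ v.[0] = 0.

Definition is_component p v : Prop := monic_original v /\ deg v = Some p.

(* [g \Po h] is the composition g(h(x)). *)
Definition collision p i C : Prop :=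
  #|` C| = i /\
  exists f : {poly F}, deg f = Some (p ^ 2)%N /\
    forall g h, (g, h) \in C ->
      [/\ is_component p g, is_component p h & f = g \Po h].

(* Applied with p the characteristic of F. *)
Definition sigma p h : {poly F} := map_poly (fun a => a ^+ p) h.

Definition frobenius_collision p C : Prop :=
  exists h, [/\ is_component p h, h <> 'X^p
              & C = [fset ('X^p, h); (sigma p h, 'X^p)]].

End Collisions.

(* Main.v *)
Require Import Defs.
From HB Require Import structures.
From mathcomp Require Import all_boot all_order all_algebra.
From mathcomp Require Import finmap.
From mathcomp Require Import zify.

(* Write g = x^p + G and h = x^p + H with deg G = deg H = k, and suppose
   2 <= k < p/2. Then f = x^(p^2) + H^p + G(x^p + H), and the first two summands
   contribute only at exponents divisible by p. Expanding the last one, the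
   coefficients of f at p(k-1) + r (1 <= r <= k) and at p(k-2) + 2k come from a
   single term each, namely k a H_r and binom(k,2) a b^2, where a and b are the
   leading coefficients of G and H. They determine b, then a, H and finally g,
   so f has at most one such decomposition. *)

Set Implicit Arguments.
Unset Strict Implicit.
Unset Printing Implicit Defensive.

Import GRing.Theory.
Local Open Scope ring_scope.

Lemma coef_exp_gt (R : comNzRingType) (H : {poly R}) (k l m : nat) :
  (size H <= k.+1)%N -> (l * k < m)%N -> (H ^+ l)`_m = 0.
Proof.
move=> sH lt_m; apply: nth_default; apply: leq_trans (size_poly_exp_leq _ _) _.
by apply: leq_trans lt_m; rewrite ltnS mulnC leq_mul2l; case: (size H) sH; lia.
Qed.

(* x^(p(i-l)) H^l has exponents between p(i-l) and p(i-l) + l k; among all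
   i <= k only i = k, l = j reaches the exponent p(k-j) + r. *)
Lemma exponent_unique (p k j r i l : nat) :
  (2 * k < p)%N -> (j <= k)%N -> (j.-1 * k < r < p)%N -> (l <= i <= k)%N ->
  (p * (i - l) <= p * (k - j) + r <= p * (i - l) + l * k)%N -> i = k /\ l = j.
Proof.
move=> lt_2k le_jk /andP[gt_r lt_r] /andP[le_li le_ik] /andP[ge_n le_n].
have le_d : (i - l <= k - j)%N.
  rewrite -ltnS -(ltn_pmul2l (m := p)); last by lia.
  by rewrite mulnS; lia.
(* If [e] were positive, p e + r <= (j + e) k together with r > (j - 1) k would give p e < (e + 1) k
   <= 2 k e, contradicting 2 k < p. *)
have [e d_eq] : exists e, (k - j = (i - l) + e)%N by exists (k - j - (i - l))%N; lia.
have le_l : (l <= j + e)%N by lia.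
have le_r : (p * e + r <= l * k)%N by move: le_n; rewrite d_eq mulnDr; lia.
have le_lk : (l * k <= (j + e) * k)%N by rewrite leq_mul2r le_l orbT.
have le_jk1 : (j * k <= j.-1 * k + k)%N by case: (j) => [|j'] /=; lia.
have e0 : e = 0%N.
  case: e {d_eq le_l} le_r le_lk => // e le_r le_lk.
  have : (2 * k * e <= p * e)%N by rewrite leq_mul2r (ltnW lt_2k) orbT.
  by rewrite mulnS in le_r; lia.
have lt_jl : (j.-1 < l)%N.
  have k_gt0 : (0 < k)%N by rewrite e0 in le_r; case: (k) gt_r le_r; lia.
  by rewrite -(ltn_pmul2r k_gt0); lia.
by lia.
Qed.

(** The binomial expansion of each (x^p + H)^i yields terms x^(p(i-l)) H^l. By [exponent_unique]
    only i = k, l = j survives, and its factor x^(p(k-j)) shifts the exponent down to r. *)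
Lemma coef_comp_XnD (R : comNzRingType) (G H : {poly R}) (p k j r : nat) :
  (2 * k < p)%N -> size G = k.+1 -> size H = k.+1 -> (j <= k)%N ->
  (j.-1 * k < r < p)%N ->
  (G \Po ('X^p + H))`_(p * (k - j) + r) = G`_k * ((H ^+ j)`_r *+ 'C(k, j)).
Proof.
move=> lt_2k sG sH le_jk r_bounds; set n := (p * (k - j) + r)%N.
have coef_term i l : (l <= i <= k)%N -> (i, l) != (k, j) ->
    (('X^p : {poly R}) ^+ (i - l) * H ^+ l)`_n = 0.
  move=> le_il neq_il; rewrite -exprM coefXnM; case: ltnP => // le_n.
  apply: (@coef_exp_gt _ _ k); first by rewrite sH.
  rewrite ltnNge; apply: contra neq_il => le_n'.
  have [|-> ->] // := exponent_unique lt_2k le_jk r_bounds le_il.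
  by rewrite -/n le_n /=; lia.
rewrite coef_comp_poly sG big_ord_recr /=.
rewrite big1 ?add0r => [|i _]; last first.
  rewrite exprDn coef_sum big1 ?mulr0 // => l _.
  rewrite coefMn coef_term ?mul0rn //.
    by have := ltn_ord l; have := ltn_ord i; lia.
  by apply/negP => /eqP[]; have := ltn_ord i; lia.
rewrite exprDn coef_sum; congr (_ * _).
have lt_j : (j < k.+1)%N by [].
rewrite (bigD1 (Ordinal lt_j)) /= ?big1 ?addr0 //.
  by rewrite coefMn -exprM coefXnM ltnNge leq_addr addKn.
move=> l neq_l; rewrite coefMn coef_term ?mul0rn //.
  by have := ltn_ord l; lia.
by apply: contra neq_l => /eqP[eq_l]; apply/eqP/val_inj.
Qed.

(* The derivative of u^p vanishes. *)
Lemma coef_exp_pchar (F : fieldType) (p : nat) (u : {poly F}) (n : nat) :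
  p \in [pchar F] -> ~~ (p %| n)%N -> (u ^+ p)`_n = 0.
Proof.
move=> pcharF; case: n => [|n] ndvd; first by rewrite dvdn0 in ndvd.
have : ((u ^+ p)^`())`_n = 0.
  by rewrite deriv_exp -scaler_nat (pcharf0 pcharF) scale0r coef0.
rewrite coef_deriv -mulr_natl => /eqP; rewrite mulf_eq0 -(dvdn_pcharf pcharF).
by rewrite (negbTE ndvd) /= => /eqP.
Qed.

(** The vanishing constant term of V is recorded because the comparison of coefficients below
    reaches H only at exponents r >= 1. *)
Lemma component_decomp (F : finFieldType) (p k : nat) (v : {poly F}) :
  (0 < p)%N -> is_component p v -> deg2 v = Some k ->
  exists V : {poly F}, [/\ v = 'X^p + V, size V = k.+1 & V`_0 = 0].
Proof.
move=> p_gt0 [[/monicP v_monic v0]]; rewrite /deg2 /deg.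
case: (v == 0) => // -[->]; rewrite v_monic scale1r.
case: (eqVneq (v - 'X^p) 0) => // V_neq0 [sV].
exists (v - 'X^p); split; first by rewrite addrC subrK.
  by rewrite -sV prednK // size_poly_gt0.
by rewrite coefB -horner_coef0 v0 coefXn ltn_eqF ?subrr.
Qed.

(** As 0 < r < p, the exponent is prime to p, so (x^p + H)^p contributes nothing and only G(x^p + H)
    remains. *)
Lemma coef_comp_component (F : fieldType) (p k j r : nat) (G H : {poly F}) :
  p \in [pchar F] -> (2 * k < p)%N -> size G = k.+1 -> size H = k.+1 ->
  (j <= k)%N -> (j.-1 * k < r < p)%N ->
  (('X^p + G) \Po ('X^p + H))`_(p * (k - j) + r) =
    'C(k, j)%:R * (G`_k * (H ^+ j)`_r).
Proof.
move=> pcharF lt_2k sG sH le_jk r_bounds.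
have ndvd : ~~ (p %| p * (k - j) + r)%N.
  case/andP: r_bounds => gt_r lt_r; rewrite dvdn_addr ?dvdn_mulr //.
  by rewrite gtnNdvd // (leq_ltn_trans _ gt_r).
rewrite comp_polyD coefD comp_Xn_poly coef_exp_pchar // add0r.
by rewrite coef_comp_XnD // mulrnAr mulr_natl.
Qed.

Lemma decomposition_unique (F : finFieldType) (p k : nat) (g h g' h' : {poly F}) :
  p \in [pchar F] -> (1 < k)%N -> (2 * k < p)%N ->
  is_component p g -> is_component p h ->
  is_component p g' -> is_component p h' ->
  deg2 g = Some k -> deg2 h = Some k -> deg2 g' = Some k -> deg2 h' = Some k ->
  g \Po h = g' \Po h' -> (g, h) = (g', h').
Proof.
move=> pcharF k_gt1 lt_2k cg ch cg' ch' dg dh dg' dh' eq_f.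
have p_gt0 : (0 < p)%N by lia.
have [G [eg sG _]] := component_decomp p_gt0 cg dg.
have [H [eh sH H0]] := component_decomp p_gt0 ch dh.
have [G' [eg' sG' _]] := component_decomp p_gt0 cg' dg'.
have [H' [eh' sH' H'0]] := component_decomp p_gt0 ch' dh'.
have lead_neq0 (V : {poly F}) : size V = k.+1 -> V`_k != 0.
  move=> sV; have := lead_coef_eq0 V.
  by rewrite lead_coefE sV -size_poly_eq0 sV /= => ->.
have natF m : (0 < m < p)%N -> (m%:R : F) != 0.
  case/andP=> m_gt0 lt_mp; rewrite -(dvdn_pcharf pcharF).
  by apply/negP => /(dvdn_leq m_gt0); lia.
have coef1 r : (1 <= r <= k)%N -> G`_k * H`_r = G'`_k * H'`_r.
  move=> r_bounds; have := congr1 (fun u : {poly F} => u`_(p * (k - 1) + r)) eq_f.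
  rewrite eg eh eg' eh' !coef_comp_component //; try lia.
  by rewrite !expr1 bin1; apply: mulfI; apply: natF; lia.
(* This is j = 2 with r = 2k, the degree of H^2, so the leading coefficient of H^2 is read off; r <
   p is exactly 2k < p. *)
have coef2 : G`_k * H`_k ^+ 2 = G'`_k * H'`_k ^+ 2.
  have := congr1 (fun u : {poly F} => u`_(p * (k - 2) + 2 * k)) eq_f.
  have lead_sqr (V : {poly F}) : size V = k.+1 -> (V ^+ 2)`_(2 * k) = V`_k ^+ 2.
    move=> sV; have := lead_coef_exp V 2.
    by rewrite !lead_coefE size_exp sV /= mulnC.
  rewrite eg eh eg' eh' !coef_comp_component //; try lia.
  rewrite !lead_sqr //; apply: mulfI.
  (* Twice the binomial is k(k - 1), and both factors lie strictly between 0 and p. *)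
  have : ('C(k, 2) * 2`!)%:R != 0 :> F.
    by rewrite bin_ffact ffactnS ffactn1 natrM mulf_neq0 // natF; lia.
  by rewrite natrM mulf_eq0 negb_or => /andP[].
have lead1 := coef1 k.
(* Dividing a b^2 = a' b'^2 by a b = a' b' gives b = b'. *)
have eq_b : H`_k = H'`_k.
  have/mulfI : G`_k * H`_k != 0 by rewrite mulf_neq0 ?lead_neq0.
  by apply; rewrite -mulrA -expr2 coef2 expr2 mulrA lead1 //; lia.
have eq_a : G`_k = G'`_k.
  have/mulIf : H`_k != 0 by rewrite lead_neq0.
  by apply; rewrite lead1 ?eq_b //; lia.
have eq_h : h = h'.
  rewrite eh eh'; congr (_ + _); apply/polyP => -[|r]; first by rewrite H0 H'0.
  have [le_rk|lt_kr] := leqP r.+1 k; last by rewrite !nth_default ?sH ?sH'.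
  have/mulfI : G`_k != 0 by rewrite lead_neq0.
  by apply; rewrite coef1 ?eq_a.
have sh : (1 < size h)%N.
  by case: ch => _; rewrite /deg; case: eqP => // _ [sh]; rewrite -ltn_predRL sh.
(* Right cancellation: (g - g') composed with the nonconstant h is zero, so g = g'. *)
congr (_, _) => //; apply/eqP; rewrite -subr_eq0.
by rewrite -(comp_poly_eq0 _ sh) comp_polyB eq_f eq_h subrr.
Qed.

Local Open Scope fset_scope.

Theorem proposition6p8 (F : finFieldType) (p : nat) (pcharF : p \in [pchar F])
    (i : nat) (i_ge2 : (2 <= i)%N) (C : {fset {poly F} * {poly F}})
    (collC : collision p i C) (nfrobC : ~ frobenius_collision p C)
    (k : nat) (k_bounds : (1 <= k < p)%N)
    (deg2C : forall g h : {poly F}, (g, h) \in C ->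
       deg2 g = Some k /\ deg2 h = Some k) :
  k = 1%N \/ (p < 2 * k)%N.
Proof.
have [-> | k_neq1] := eqVneq k 1%N; first by left.
right; rewrite ltnNge; apply/negP => le_2k.
have k_gt1 : (1 < k)%N.
  by case/andP: k_bounds => k_gt0 _; rewrite ltn_neqAle eq_sym k_neq1.
have p_prime := pcharf_prime pcharF.
(* If p = 2k, then k divides the prime p, so k is 1 or p = 2k, both excluded. *)
have lt_2k : (2 * k < p)%N.
  rewrite ltn_neqAle le_2k andbT; apply: contra k_neq1 => /eqP p_eq.
  have /primeP[_ /(_ k)] := p_prime; rewrite -p_eq dvdn_mull // => /(_ isT).
  by case/pred2P => [-> // | k_eq]; lia.
case: collC => cardC [f [_ decomp]].
have C_sub u v : u \in C -> v \in C -> u = v.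
  case: u v => [g h] [g' h'] uC vC.
  have [cg ch fE] := decomp _ _ uC; have [cg' ch' fE'] := decomp _ _ vC.
  have [dg dh] := deg2C _ _ uC; have [dg' dh'] := deg2C _ _ vC.
  by apply: (decomposition_unique (p := p) (k := k)) => //; rewrite -fE.
have : (#|` C| <= 1)%N.
  have [x xC] : exists x, x \in C.
    by apply/fset0Pn; rewrite -cardfs_gt0 cardC ltnW.
  rewrite -(cardfs1 x); apply/fsubset_leq_card/fsubsetP => u uC.
  by rewrite (C_sub u x) ?inE.
by rewrite cardC leqNgt i_ge2.
Qed.
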